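(* For any labeled poset $(P,\omega)$ with $|P|\ge2$, $$\Omega(P,\omega;t)=\Delta^{-1}\sum_{\emptyset\ne S\in\mathcal I_\omega(P)}\Omega(P\setminus S,\omega;t).$$
   Context: All posets are finite and $\mathbb N^+=\{1,2,\dots\}$, $[n]=\{1,\dots,n\}$. An ideal of a poset $P$ is a down-closed subset (including $\emptyset$ and $P$). A labeled poset $(P,\omega)$ is a finite poset $P$ with an injective map $\omega:P\to\mathbb N^+$; each subset $S\subseteq P$ carries the induced order and labeling, giving a labeled poset $(S,\omega)$. A subset $S$ is $\omega$-natural if $\omega|_S$ is order-preserving; $\mathcal I_\omega(P)$ is the set of ideals of $P$ that are $\omega$-natural. A map $f:P\to[n]$ is $\omega$-order-preserving if it is order-preserving and $f(x)>f(y)$ whenever $x>y$ in $P$ and $\omega(x)<\omega(y)$. The order polynomial $\Omega(P,\omega;t)$ is the unique polynomial in $t$ whose value at each $n\in\mathbb N^+$ is the number of $\omega$-order-preserving maps $P\to[n]$; $\Omega(\emptyset,\omega;t)=1$. The operator $\Delta$ on $\mathbb C[t]$ is $(\Delta f)(t)=f(t+1)-f(t)$, and $\Delta^{-1}:\mathbb C[t]\to\mathbb C[t]$ is the linear operator sending $f$ to the unique polynomial $g$ with $g(0)=0$ and $\Delta g=f$. *)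

(* Defs.v *)
From HB Require Import structures.
From mathcomp Require Import all_boot all_order all_algebra.
From mathcomp Require Import classical_sets.

Set Implicit Arguments.
Unset Strict Implicit.
Unset Printing Implicit Defensive.

Import Order.TTheory GRing.Theory.
Local Open Scope ring_scope.

Definition subposet (d : Order.disp_t) (P : finPOrderType d) (S : {set P}) :=
  {x : P | x \in S}.

HB.instance Definition _ (d : Order.disp_t) (P : finPOrderType d)
  (S : {set P}) := SubFinite.on (subposet S).
HB.instance Definition _ (d : Order.disp_t) (P : finPOrderType d)
  (S : {set P}) := [SubChoice_isSubPOrder of subposet S by <: with d].

Section LabeledPosets.
Variables (d : Order.disp_t) (P : finPOrderType d).

Definition is_labeling (w : P -> nat) : Prop :=
  injective w /\ (forall x : P, 0 < w x)%N.

Definition sublabel (w : P -> nat) (S : {set P}) : subposet S -> nat :=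
  fun x => w (val x).

Definition is_ideal (S : {set P}) : bool :=
  [forall x in S, forall y : P, (y <= x)%O ==> (y \in S)].

Definition is_natural (w : P -> nat) (S : {set P}) : bool :=
  [forall x in S, forall y in S, (x <= y)%O ==> (w x <= w y)%N].

Definition natural_ideals (w : P -> nat) : {set {set P}} :=
  finset (fun S : {set P} => is_ideal S && is_natural w S).

(* The chain [n] = {1, ..., n} is rendered by the isomorphic chain
   'I_n = {0, ..., n - 1}. *)
Definition label_order_preserving (w : P -> nat) (n : nat)
    (f : {ffun P -> 'I_n}) : bool :=
  [forall x : P, forall y : P,
     ((y <= x)%O ==> (f y <= f x)%N)
     && ((y < x)%O && (w x < w y)%N ==> (f y < f x)%N)].

Definition is_order_poly (F : fieldType) (w : P -> nat) (p : {poly F}) : Prop :=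
  forall n : nat, (0 < n)%N ->
    p.[n%:R] = #|[pred f : {ffun P -> 'I_n} | label_order_preserving w f]|%:R.

(* "The" polynomial with the given values: it exists and is unique when F has
   characteristic 0; the default value 0 of xget is then never used. *)
Definition order_poly (F : fieldType) (w : P -> nat) : {poly F} :=
  xget 0 (fun p : {poly F} => is_order_poly w p).

End LabeledPosets.

Arguments sublabel {d P} w S.
Arguments order_poly {d} P F w.

Definition poly_diff (F : fieldType) (p : {poly F}) : {poly F} :=
  p \Po ('X + 1) - p.

(* Again a definite description, well defined in characteristic 0. *)
Definition poly_diffV (F : fieldType) (p : {poly F}) : {poly F} :=
  xget 0 (fun q : {poly F} => q.[0] = 0 /\ poly_diff q = p).

(* Main.v *)
Require Import Defs.
From mathcomp Require Import all_boot all_order all_algebra.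
From mathcomp Require classical_sets.
From mathcomp Require Import reals complex.

Set Implicit Arguments.
Unset Strict Implicit.
Unset Printing Implicit Defensive.

Import Order.TTheory GRing.Theory.
Local Open Scope ring_scope.

(* Let N(P, n) be the number of w-order-preserving maps P -> {0, ..., n-1}.
   The fibre S over 0 of such a map into {0, ..., n} is an ideal, and it is
   w-natural because the map is constant on it; away from S the map is an
   arbitrary w-order-preserving map into {1, ..., n}.  Hence
   N(P, n+1) = \sum_S N(P \ S, n), where S ranges over the w-natural ideals, and
   the term S = set0 is N(P, n).  By induction on #|P| the count N(P, n) is
   thus polynomial in n for all n >= 0, including n = 0, where it vanishes if
   P is nonempty. *)

(** * Finite differences of polynomials in characteristic 0 *)

Section FiniteDifferences.
Variables (F : fieldType) (F0 : [pchar F] =i pred0).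

Lemma natr_inj_pchar0 : injective (fun n : nat => n%:R : F).
Proof.
have natr_eq0 := (pcharf0P F).1 F0.
suff le_inj m n : (m <= n)%N -> m%:R = n%:R :> F -> m = n.
  move=> m n mn; have [le_mn|/ltnW le_nm] := leqP m n; first exact: le_inj.
  exact: esym (le_inj _ _ le_nm (esym mn)).
move=> le_mn mn; apply/eqP; rewrite eqn_leq le_mn -subn_eq0 -natr_eq0.
by rewrite natrB ?mn ?subrr ?eqxx.
Qed.

(** A nonzero [p - q] would have at least [size (p - q)] distinct roots, one more than its degree
    allows; characteristic 0 keeps the roots distinct. *)
Lemma poly_eq_on_pos_nat (p q : {poly F}) :
  (forall n : nat, (0 < n)%N -> p.[n%:R] = q.[n%:R]) -> p = q.
Proof.
move=> pq; apply/eqP; rewrite -subr_eq0; apply/negPn/negP => nz.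
pose rs := [seq n%:R : F | n <- iota 1 (size (p - q))].
have /(max_poly_roots nz) : all (root (p - q)) rs.
  apply/allP => _ /mapP[n n_in ->]; rewrite rootE hornerD hornerN pq ?subrr //.
  by move: n_in; rewrite mem_iota => /andP[].
rewrite (map_inj_uniq natr_inj_pchar0) iota_uniq => /(_ isT).
by rewrite size_map size_iota ltnn.
Qed.

Lemma horner_poly_diff (p : {poly F}) x :
  (poly_diff p).[x] = p.[x + 1] - p.[x].
Proof. by rewrite /poly_diff !hornerE horner_comp !hornerE. Qed.

Lemma poly_diffD (p q : {poly F}) :
  poly_diff (p + q) = poly_diff p + poly_diff q.
Proof. by rewrite /poly_diff comp_polyD opprD addrACA. Qed.

Lemma poly_diffZ c (p : {poly F}) : poly_diff (c *: p) = c *: poly_diff p.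
Proof. by rewrite /poly_diff comp_polyZ scalerBr. Qed.

(** Binomial expansion with the top term split off: differencing lowers the degree by exactly one
    and gives leading coefficient [n.+1]. *)
Lemma poly_diffXn n :
  poly_diff ('X^(n.+1) : {poly F}) =
  (n.+1%:R : F) *: 'X^n + \sum_(i < n) ('C(n.+1, i)%:R : F) *: 'X^i.
Proof.
rewrite /poly_diff comp_Xn_poly ['X + 1]addrC exprDn.
rewrite (eq_bigr (fun i : 'I_n.+2 => ('C(n.+1, i)%:R : F) *: 'X^i)) => [|i _].
  by rewrite big_ord_recr big_ord_recr /= binn scale1r binSn addrK addrC.
by rewrite expr1n mul1r scaler_nat.
Qed.

(** Induction on a bound for the size of [p]: a multiple of the difference of ['X^(n.+1)] cancels
    the coefficient of ['X^n]. *)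
Lemma poly_diff_surj (p : {poly F}) :
  exists q : {poly F}, q.[0] = 0 /\ poly_diff q = p.
Proof.
have [n] := ubnP (size p); elim: n p => // n IHn p; rewrite ltnS => le_pn.
case: n => [|n] in IHn le_pn *.
  exists 0; rewrite horner0 /poly_diff comp_poly0 subr0; split=> //.
  by apply/esym/eqP; rewrite -size_poly_eq0 -leqn0.
have nz : n.+1%:R != 0 :> F by rewrite ((pcharf0P F).1 F0).
(* With this [a], the coefficient of degree [n] in [p - a *: poly_diff 'X^(n.+1)] is zero, so the
   size drops. *)
pose a := p`_n / n.+1%:R.
have [|q [q0 dq]] := IHn (p - a *: poly_diff 'X^(n.+1)).
  rewrite ltnS; apply/leq_sizeP => j le_nj.
  rewrite coefB coefZ poly_diffXn coefD coefZ coefXn coef_sum big1 => [|i _].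
    move: le_nj; rewrite addr0 leq_eqVlt => /predU1P[<-|lt_nj].
      by rewrite eqxx mulr1 divfK // subrr.
    by rewrite gtn_eqF // !mulr0 subr0 nth_default // (leq_trans le_pn).
  by rewrite coefZ coefXn gtn_eqF ?mulr0 // (leq_trans (ltn_ord i)).
exists (q + a *: 'X^(n.+1)); rewrite poly_diffD poly_diffZ dq subrK.
by rewrite !hornerE q0 expr0n mulr0 addr0.
Qed.

(** The value at 0 and the difference determine all values at natural numbers by induction, hence
    the polynomial; so [xget] can only return [q]. *)
Lemma poly_diffV_unique (p q : {poly F}) :
  q.[0] = 0 -> poly_diff q = p -> poly_diffV p = q.
Proof.
move=> q0 dq; apply: classical_sets.xget_unique => // r [r0 dr].
suff rq n : r.[n%:R] = q.[n%:R] by apply: poly_eq_on_pos_nat.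
elim: n => [|n IHn]; first by rewrite r0 q0.
have := congr1 (fun u : {poly F} => u.[n%:R]) dr; rewrite -dq !horner_poly_diff.
by rewrite IHn -natr1 => /addIr.
Qed.

End FiniteDifferences.

(** * Order-preserving maps and their zero fibres *)

Section Counting.
Variables (d : Order.disp_t) (P : finPOrderType d) (w : P -> nat).

Definition count_maps (n : nat) : nat :=
  #|[pred f : {ffun P -> 'I_n} | label_order_preserving w f]|.

Lemma label_order_preservingP n (f : {ffun P -> 'I_n}) :
  reflect (forall x y : P, ((y <= x)%O -> (f y <= f x)%N) /\
             ((y < x)%O -> (w x < w y)%N -> (f y < f x)%N))
          (label_order_preserving w f).
Proof.
apply: (iffP forallP) => [lop x y|lop x].
  have /andP[/implyP le_f /implyP lt_f] := forallP (lop x) y.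
  by split=> // lt_yx lt_w; apply: lt_f; rewrite lt_yx.
apply/forallP => y; have [le_f lt_f] := lop x y.
by apply/andP; split; apply/implyP => // /andP[]; apply: lt_f.
Qed.

End Counting.

Section ZeroFibre.
Variables (d : Order.disp_t) (P : finPOrderType d) (w : P -> nat).

Definition zero_fibre n (f : {ffun P -> 'I_n.+1}) : {set P} :=
  [set x | f x == ord0].

Lemma zero_fibre_natural_ideal n (f : {ffun P -> 'I_n.+1}) :
  label_order_preserving w f -> zero_fibre f \in natural_ideals w.
Proof.
move=> /label_order_preservingP lop; rewrite inE; apply/andP; split.
  apply/forall_inP => x; rewrite inE => /eqP fx0.
  apply/forallP => y; apply/implyP => /(proj1 (lop x y)).
  by rewrite fx0 leqn0 inE.
apply/forall_inP => x; rewrite inE => /eqP fx0.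
apply/forall_inP => y; rewrite inE => /eqP fy0.
apply/implyP; rewrite le_eqVlt => /predU1P[->//|lt_xy].
by rewrite leqNgt; apply/negP => /(proj2 (lop y x) lt_xy); rewrite fx0 fy0.
Qed.

(** Values off [S] are shifted up by one through [lift ord0], so that the zero fibre is exactly
    [S]. *)
Definition extend_by_zero (S : {set P}) n
    (g : {ffun subposet (~: S) -> 'I_n}) : {ffun P -> 'I_n.+1} :=
  [ffun x => if insub x is Some u then lift ord0 (g u) else ord0].

Lemma extend_by_zero_in (S : {set P}) n
    (g : {ffun subposet (~: S) -> 'I_n}) x :
  x \in S -> extend_by_zero g x = ord0.
Proof. by move=> xS; rewrite ffunE insubN // inE xS. Qed.

Lemma extend_by_zero_val (S : {set P}) n
    (g : {ffun subposet (~: S) -> 'I_n}) u :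
  extend_by_zero g (val u) = lift ord0 (g u).
Proof. by rewrite ffunE valK. Qed.

Lemma extend_by_zero_inj (S : {set P}) n : injective (@extend_by_zero S n).
Proof.
move=> g h /ffunP gh; apply/ffunP => u; have := gh (val u).
by rewrite !extend_by_zero_val => /lift_inj.
Qed.

Lemma zero_fibre_extend (S : {set P}) n
    (g : {ffun subposet (~: S) -> 'I_n}) : zero_fibre (extend_by_zero g) = S.
Proof.
apply/setP => x; rewrite inE; have [xS|xNS] := boolP (x \in S).
  by rewrite extend_by_zero_in ?eqxx.
have xC : x \in ~: S by rewrite inE.
by rewrite (extend_by_zero_val g (Sub x xC)).
Qed.

Lemma extend_by_zero_surj n (f : {ffun P -> 'I_n.+1}) :
  exists g : {ffun subposet (~: zero_fibre f) -> 'I_n}, f = extend_by_zero g.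
Proof.
(* A value other than [ord0] lies in the image of [lift ord0]; finite choice collects the preimages
   into one map. *)
have /fin_all_exists[g fE] (u : subposet (~: zero_fibre f)) :
    exists i : 'I_n, f (val u) = lift ord0 i.
  have := valP u; rewrite !inE eq_sym => /unlift_some[i fu _]; by exists i.
exists [ffun u => g u]; apply/ffunP => x.
have [xS|xNS] := boolP (x \in zero_fibre f).
  by rewrite extend_by_zero_in //; move: xS; rewrite inE => /eqP.
have xC : x \in ~: zero_fibre f by rewrite inE.
by rewrite (extend_by_zero_val _ (Sub x xC)) ffunE -fE.
Qed.

(** Only pairs meeting [S] need an argument. Inside [S], naturality rules out the strict condition;
    for [y] in [S] and [x] outside, zero is below a positive value; for [x] in [S] and [y] outside,
    [y <= x] would contradict that [S] is an ideal. *)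
Lemma extend_by_zero_preserving (S : {set P}) n
    (g : {ffun subposet (~: S) -> 'I_n}) :
    S \in natural_ideals w ->
  label_order_preserving w (extend_by_zero g) =
  label_order_preserving (sublabel w (~: S)) g.
Proof.
rewrite inE => /andP[/forall_inP idS /forall_inP natS].
apply/label_order_preservingP/label_order_preservingP => lop.
  move=> u v; have := lop (val u) (val v); rewrite !extend_by_zero_val.
  by rewrite !lift0 !ltnS.
move=> x y; have [yS|yNS] := boolP (y \in S).
  rewrite (extend_by_zero_in g yS); split=> // lt_yx lt_w.
  have [xS|xNS] := boolP (x \in S).
    have /implyP/(_ (ltW lt_yx)) := forall_inP (natS y yS) x xS.
    by rewrite leqNgt lt_w.
  have xC : x \in ~: S by rewrite inE.
  by rewrite (extend_by_zero_val g (Sub x xC)).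
have [xS|xNS] := boolP (x \in S).
  have NSle : ~~ (y <= x)%O.
    by apply: contra yNS => le_yx; apply: (implyP (forallP (idS x xS) y)).
  by split=> [/(negP NSle)//|/ltW/(negP NSle)].
have xC : x \in ~: S by rewrite inE.
have yC : y \in ~: S by rewrite inE.
have := lop (Sub x xC) (Sub y yC).
by rewrite (extend_by_zero_val g (Sub x xC)) (extend_by_zero_val g (Sub y yC))
           !lift0 !ltnS.
Qed.

End ZeroFibre.

(** * The recursion for the count and its boundary values *)

Lemma count_mapsS (d : Order.disp_t) (P : finPOrderType d) (w : P -> nat) n :
  count_maps w n.+1 =
  (\sum_(S in natural_ideals w) count_maps (sublabel w (~: S)) n)%N.
Proof.
rewrite /count_maps -sum1_card.
rewrite (partition_big (@zero_fibre _ _ n) (mem (natural_ideals w))) /=;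
  last by move=> f; apply: zero_fibre_natural_ideal.
apply: eq_bigr => S S_nat; rewrite sum1_card.
rewrite -(card_image (@extend_by_zero_inj _ _ S n)); apply: eq_card => f.
rewrite unfold_in inE; apply/andP/imageP => [[lop /eqP fS]|[g g_lop ->]].
  (* The type of [g] mentions [zero_fibre f], so [g] is generalized before that set is replaced by
     [S]. *)
  have [g fE] := extend_by_zero_surj f; move: g fE; rewrite fS => g fE.
  by exists g; rewrite // inE -extend_by_zero_preserving // -fE.
by rewrite zero_fibre_extend extend_by_zero_preserving.
Qed.

Lemma set0_natural_ideal (d : Order.disp_t) (P : finPOrderType d)
  (w : P -> nat) : set0 \in natural_ideals w.
Proof.
by rewrite inE; apply/andP; split; apply/forall_inP => x; rewrite inE.
Qed.

Lemma card_subposet (d : Order.disp_t) (P : finPOrderType d) (S : {set P}) :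
  #|{: subposet S}| = #|S|.
Proof. exact: card_sig. Qed.

(** The type [subposet (~: set0)] is only isomorphic to [P], so the two counts are matched by
    restriction of maps. *)
Lemma count_maps_setT (d : Order.disp_t) (P : finPOrderType d)
    (w : P -> nat) n :
  count_maps (sublabel w (~: set0)) n = count_maps w n.
Proof.
have inC (x : P) : x \in ~: set0 by rewrite !inE.
pose restr (f : {ffun P -> 'I_n}) : {ffun subposet (~: set0 : {set P}) -> 'I_n} :=
  [ffun u => f (val u)].
have restr_inj : injective restr.
  move=> f g /ffunP fg; apply/ffunP => x.
  by have := fg (Sub x (inC x)); rewrite !ffunE.
rewrite /count_maps -(card_image restr_inj); apply: eq_card => g.
rewrite !inE; apply/idP/imageP => [g_lop|[f]].
  exists [ffun x => g (Sub x (inC x))].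
    apply/label_order_preservingP => x y; rewrite !ffunE.
    exact: (label_order_preservingP _ _ g_lop (Sub x (inC x)) (Sub y (inC y))).
  by apply/ffunP => u; rewrite !ffunE; congr (g _); apply: val_inj.
rewrite inE => /label_order_preservingP f_lop ->.
apply/label_order_preservingP => u v; rewrite !ffunE.
exact: f_lop (val u) (val v).
Qed.

Lemma count_maps_diff (d : Order.disp_t) (P : finPOrderType d)
    (w : P -> nat) n :
  count_maps w n.+1 =
  (count_maps w n +
   \sum_(S : {set P} | (S != set0) && (S \in natural_ideals w))
      count_maps (sublabel w (~: S)) n)%N.
Proof.
rewrite count_mapsS (bigD1 set0) ?set0_natural_ideal //= count_maps_setT.
by congr addn; apply: eq_bigl => S; rewrite andbC.
Qed.

Lemma count_maps_empty (d : Order.disp_t) (P : finPOrderType d)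
    (w : P -> nat) n : #|P| = 0%N -> count_maps w n = 1%N.
Proof.
move=> P0; rewrite /count_maps; have noP (x : P) : False.
  by have := fintype0 x P0.
rewrite (eq_card (B := predT)) ?card_ffun ?P0 // => f.
by rewrite !inE; apply/forallP => x; case: (noP x).
Qed.

Lemma count_maps0 (d : Order.disp_t) (P : finPOrderType d)
    (w : P -> nat) : (0 < #|P|)%N -> count_maps w 0 = 0%N.
Proof.
move=> /card_gt0P[x _]; rewrite /count_maps; apply: eq_card0 => f.
by case: (f x).
Qed.

(** * Existence of the order polynomial and its difference equation *)

Section OrderPolynomial.
Variables (F : fieldType) (F0 : [pchar F] =i pred0).

Lemma count_maps_poly (d : Order.disp_t) (P : finPOrderType d) (w : P -> nat) :
  exists p : {poly F}, forall n, p.[n%:R] = (count_maps w n)%:R.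
Proof.
have [m] := ubnP #|P|; elim: m => // m IHm in P w *; rewrite ltnS => le_Pm.
have [P0|P_gt0] := posnP #|P|.
  by exists 1 => n; rewrite hornerE count_maps_empty.
have /fin_all_exists[r rE] (S : {set P}) : exists p : {poly F},
    S != set0 -> forall n, p.[n%:R] = (count_maps (sublabel w (~: S)) n)%:R.
  (* The induction hypothesis needs a smaller complement, hence [S] nonempty; the value 0 at [set0]
     is a dummy that the sum below skips. *)
  have [->|S_n0] := eqVneq S set0; first by exists 0.
  have [|p pE] := IHm _ (sublabel w (~: S)); last by exists p.
  rewrite card_subposet (leq_trans _ le_Pm) // -(cardsC S) -[ltnLHS]add0n.
  by rewrite ltn_add2r card_gt0.
have [q [q0 dq]] := poly_diff_surj F0
  (\sum_(S : {set P} | (S != set0) && (S \in natural_ideals w)) r S).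
(* The normalization [q.[0] = 0] fits because a nonempty poset has no map to ['I_0]; from there both
   sides have the same increments. *)
exists q; elim=> [|n IHn]; first by rewrite q0 count_maps0.
have /eqP := congr1 (fun u : {poly F} => u.[n%:R]) dq.
rewrite horner_poly_diff natr1 IHn subr_eq => /eqP ->.
rewrite count_maps_diff natrD addrC horner_sum natr_sum.
by congr (_ + _); apply: eq_bigr => S /andP[S_n0 _]; apply: rE.
Qed.

(* Also at n = 0, which [is_order_poly] leaves unconstrained. *)
Lemma horner_order_poly (d : Order.disp_t) (P : finPOrderType d)
    (w : P -> nat) n : (order_poly P F w).[n%:R] = (count_maps w n)%:R.
Proof.
have [p pE] := count_maps_poly w.
have pP : is_order_poly w p by move=> k _; exact: pE.
rewrite /order_poly (classical_sets.xget_unique _ pP) // => q qP.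
by apply: (poly_eq_on_pos_nat F0) => k k_gt0; rewrite qP // pE.
Qed.

Lemma order_poly_diffV (d : Order.disp_t) (P : finPOrderType d)
    (w : P -> nat) : (0 < #|P|)%N ->
  order_poly P F w =
  poly_diffV
    (\sum_(S : {set P} | (S != set0) && (S \in natural_ideals w))
        order_poly (subposet (~: S)) F (sublabel w (~: S))).
Proof.
move=> P_gt0; apply/esym/(poly_diffV_unique F0).
  (* The point 0 is read as [0%:R], so that the polynomial is evaluated by the count at [n = 0]. *)
  by rewrite -[0]/(0%:R) horner_order_poly count_maps0.
apply: (poly_eq_on_pos_nat F0) => n _.
rewrite horner_poly_diff natr1 !horner_order_poly count_maps_diff natrD addrC.
rewrite addKr horner_sum natr_sum.
by apply: eq_bigr => S _; rewrite horner_order_poly.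
Qed.

End OrderPolynomial.

Theorem theorem2p7 (R : realType) (d : Order.disp_t) (P : finPOrderType d)
    (w : P -> nat) (hw : is_labeling w) (hP : (2 <= #|P|)%N) :
  order_poly P R[i] w =
  poly_diffV
    (\sum_(S : {set P} | (S != set0) && (S \in natural_ideals w))
        order_poly (subposet (~: S)) R[i] (sublabel w (~: S))).
Proof. exact/order_poly_diffV/ltnW/hP/Num.Theory.pchar_num. Qed.
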